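(* Let $L$ be a $1$-bounded, one-sorted metric signature and let $M$ be an $\omega$-saturated, strongly pseudofinite $L$-structure. Let $f\colon M\to M$ be a formula-definable function. If $f$ is injective, then $f$ is surjective.
   Context: Continuous first-order logic for metric structures (Ben Yaacov–Berenstein–Henson–Usvyatsov) is used. For a $1$-bounded one-sorted metric signature $L$, $L$-structures are complete metric spaces of diameter at most $1$ with interpretations of constant, function and $[0,1]$-valued predicate symbols, each function and predicate symbol obeying a modulus of uniform continuity specified by $L$. Connectives are all continuous functions $[0,1]^n\to[0,1]$, quantifiers are $\sup$ and $\inf$. The value of a sentence $\sigma$ in $M$ is $\sigma^M\in[0,1]$. A structure is finite if its underlying set is. $M$ is $\omega$-saturated if every set of conditions (of the form $\varphi(x)=0$, $x$ a finite tuple) with parameters from a finite subset of $M$ all of whose finite subsets are realized in $M$ is realized in $M$. $M$ is strongly pseudofinite if for every $L$-sentence $\sigma$ with $\sigma^M=0$ there is a finite $L$-structure $A$ with $\sigma^A=0$. $f\colon M\to M$ is formula-definable if there are an $L$-formula $\varphi(x,y,z)$, with $z$ a (finite) tuple of variables, and a tuple $a$ from $M$ such that $d(f(x),y)=\varphi^M(x,y,a)$ for all $x,y\in M$. *)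

(* Defs.v *)
From HB Require Import structures.
From mathcomp Require Import all_boot all_order all_algebra.
From mathcomp Require Import all_classical all_reals all_analysis.

Set Implicit Arguments.
Unset Strict Implicit.
Unset Printing Implicit Defensive.

Import Order.TTheory GRing.Theory Num.Theory.
Import numFieldNormedType.Exports.

Local Open Scope classical_set_scope.
Local Open Scope ring_scope.

(* Continuous first-order logic for 1-bounded one-sorted metric structures,
   after Ben Yaacov, Berenstein, Henson and Usvyatsov (BBHU).
   An n-tuple of elements of M is a function 'I_n -> M. *)

#[short(type="completeMetricType")]
HB.structure Definition CompleteMetric (R : numDomainType) :=
  { M of Complete M & Metric R M }.

(* Only the values of a modulus on ]0, 1] are meaningful. *)
Record modulus (R : realType) := Modulus {
  modulus_fun :> R -> R ;
  modulusP : forall e, 0 < e <= 1 -> 0 < modulus_fun e <= 1 }.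

Record signature (R : realType) := Signature {
  csym : Type ;
  fsym : Type ;
  farity : fsym -> nat ;
  fmodulus : fsym -> modulus R ;
  psym : Type ;
  parity : psym -> nat ;
  pmodulus : psym -> modulus R }.

(* The strict and the weak inequality are those of BBHU; the premise on x and y
   says that their distance in the maximum metric on tuples is < Delta e. *)
Definition obeys_modulus (R : realType) (M : metricType R) (n : nat)
    (T : Type) (dT : T -> T -> R) (Delta : modulus R)
    (g : ('I_n -> M) -> T) : Prop :=
  forall (e : R) (x y : 'I_n -> M), 0 < e <= 1 ->
    (forall i, mdist (x i) (y i) < Delta e) -> dT (g x) (g y) <= e.

(* As usual in first-order logic, structures are nonempty. *)
Record structure (R : realType) (L : signature R) := Structure {
  carrier :> completeMetricType R ;
  carrier_inhabited : inhabited carrier ;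
  diam_le1 : forall x y : carrier, mdist x y <= 1 ;
  cinterp : csym L -> carrier ;
  finterp : forall s : fsym L, ('I_(farity s) -> carrier) -> carrier ;
  finterpP : forall s : fsym L,
    obeys_modulus (@mdist R carrier) (fmodulus s) (@finterp s) ;
  pinterp : forall s : psym L, ('I_(parity s) -> carrier) -> R ;
  pinterp_itv : forall (s : psym L) (x : 'I_(parity s) -> carrier),
    0 <= pinterp x <= 1 ;
  pinterpP : forall s : psym L,
    obeys_modulus (fun a b : R => `|a - b|) (pmodulus s) (@pinterp s) }.

Definition cube (R : realType) (k : nat) : set 'rV[R]_k :=
  [set v | forall i, 0 <= v ord0 i <= 1].
Arguments cube : clear implicits.

(* A continuous function [0,1]^k -> [0,1], with junk values outside [0,1]^k. *)
Record connective (R : realType) (k : nat) := Connective {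
  connective_fun :> 'rV[R]_k -> R ;
  connective_continuous : {within cube R k, continuous connective_fun} ;
  connective_itv : forall v, cube R k v -> 0 <= connective_fun v <= 1 }.

Inductive term (R : realType) (L : signature R) (n : nat) : Type :=
| Var of 'I_n
| Cst of csym L
| App (s : fsym L) of ('I_(farity s) -> term L n).

(* formula L n: formulas with free variables among n variables; Sup and Inf
   bind variable 0, the other variables being shifted by one. *)
Inductive formula (R : realType) (L : signature R) : nat -> Type :=
| Dist (n : nat) of term L n & term L n : formula L n
| Pred (n : nat) (s : psym L) of ('I_(parity s) -> term L n) : formula L n
| Conn (n k : nat) of connective R k & ('I_k -> formula L n) : formula L n
| Sup (n : nat) of formula L n.+1 : formula L n
| Inf (n : nat) of formula L n.+1 : formula L n.

Definition sentence (R : realType) (L : signature R) : Type := formula L 0.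

Definition tuple0 (T : Type) : 'I_0 -> T :=
  fun i => False_rect T (notF (ltn_ord i)).

Definition tcons (T : Type) (n : nat) (x : T) (v : 'I_n -> T) : 'I_n.+1 -> T :=
  fun i => if unlift ord0 i is Some j then v j else x.

Definition tcat (T : Type) (m n : nat) (u : 'I_m -> T) (v : 'I_n -> T) :
    'I_(m + n) -> T :=
  fun i => match fintype.split i with inl j => u j | inr j => v j end.

Fixpoint tvalue (R : realType) (L : signature R) (M : structure L) (n : nat)
    (v : 'I_n -> M) (t : term L n) : M :=
  match t with
  | Var i => v i
  | Cst c => cinterp M c
  | App s ts => finterp (fun i => tvalue v (ts i))
  end.

Fixpoint value (R : realType) (L : signature R) (M : structure L) (n : nat)
    (phi : formula L n) : ('I_n -> M) -> R :=
  match phi in formula _ m return ('I_m -> M) -> R with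
  | Dist _ t u => fun v => mdist (tvalue v t) (tvalue v u)
  | Pred _ s ts => fun v => pinterp (fun i => tvalue v (ts i))
  | Conn _ _ u phis => fun v => u (\row_i value (phis i) v)
  | Sup _ psi => fun v => sup (range (fun x : M => value psi (tcons x v)))
  | Inf _ psi => fun v => inf (range (fun x : M => value psi (tcons x v)))
  end.

Definition sentence_value (R : realType) (L : signature R) (M : structure L)
    (sigma : sentence L) : R := value sigma (@tuple0 M).

Definition finite_structure (R : realType) (L : signature R)
    (A : structure L) : Prop := finite_set [set: A].

Definition strongly_pseudofinite (R : realType) (L : signature R)
    (M : structure L) : Prop :=
  forall sigma : sentence L, sentence_value M sigma = 0 ->
    exists A : structure L, finite_structure A /\ sentence_value A sigma = 0.

(* x realizes the conditions phi(x, a) = 0 for phi in Sigma. *)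
Definition realizes (R : realType) (L : signature R) (M : structure L)
    (n k : nat) (a : 'I_k -> M) (Sigma : set (formula L (n + k)))
    (x : 'I_n -> M) : Prop :=
  forall phi, Sigma phi -> value phi (tcat x a) = 0.

(* The finite set of parameters is given by an enumeration a. *)
Definition omega_saturated (R : realType) (L : signature R)
    (M : structure L) : Prop :=
  forall (n k : nat) (a : 'I_k -> M) (Sigma : set (formula L (n + k))),
    (forall Sigma0, finite_set Sigma0 -> Sigma0 `<=` Sigma ->
       exists x, realizes a Sigma0 x) ->
    exists x, realizes a Sigma x.

Definition formula_definable (R : realType) (L : signature R)
    (M : structure L) (f : M -> M) : Prop :=
  exists (k : nat) (phi : formula L k.+2) (a : 'I_k -> M),
    forall x y : M, mdist (f x) y = value phi (tcons x (tcons y a)).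

(* Main.v *)
Require Import Defs.
From mathcomp Require Import all_boot all_order all_algebra.
From mathcomp Require Import finmap.
From mathcomp Require Import all_classical all_reals all_analysis.

Set Implicit Arguments.
Unset Strict Implicit.
Unset Printing Implicit Defensive.

Import Order.TTheory GRing.Theory Num.Theory.
Import numFieldNormedType.Exports.

Local Open Scope classical_set_scope.
Local Open Scope ring_scope.

(* Let y0 be outside the range of f, where d(f x, y) = phi(x, y, a).  Consider
   the set S of the quadruples
     (d(x, x'), phi(x, y, a), phi(x', y, a), phi(x, y0, a))
   taken in M over all x, x' and y = f x.  By saturation S is closed, so it is
   the zero set of a connective u, and the sentence
     inf_(y0, a) sup_x inf_y sup_x' u(quadruple)
   vanishes in M, hence in a finite A.  There infima are attained: for some
   (y0, a) there is g with all quadruples for (x, x', g x) in S.  On S the second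
   entry is 0, the first is 0 as soon as the third is (f is injective), and the
   fourth is never 0 (y0 is not a value of f).  Hence g is injective, so it is
   onto A, but it omits y0.  Only phi(x, g x, a) = 0 is used in A: phi need not
   define a function there. *)

(** * Finite sets, filters and injective self-maps *)

Lemma filter_finite_forall (T I : Type) (F : set_system T) (D : set I)
    (P : I -> set T) :
  Filter F -> finite_set D -> (forall i, D i -> F (P i)) ->
  F [set x | forall i, D i -> P i x].
Proof.
move=> FF finD FP.
(* The finite intersection is indexed by an [fset], which asks for a choice type; [{classic I}]
   makes one out of the bare type [I]. *)
have memD (i : {classic I}) : (i \in @fset_set {classic I} D) = (i \in (D : set {classic I})).
  exact: (@in_fset_set {classic I}).
have := @filter_bigI T {classic I} (@fset_set {classic I} D) P F FF.
move=> /(_ _)/filterS; apply.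
  by move=> x + i Di; apply => /=; rewrite memD mem_set.
by move=> i; rewrite memD inE => /FP.
Qed.

(** If [y] were not a value of [g], its iterates under [g] would be pairwise distinct, and [nat]
    would embed in the finite type [T]. *)
Lemma finite_injective_surjective (T : Type) (g : T -> T) :
  finite_set [set: T] -> injective g -> forall y, exists x, g x = y.
Proof.
move=> finT ginj y; apply: contrapT => ny.
suff orbit_inj i j : iter i g y = iter j g y -> i = j.
  apply: infinite_nat.
  rewrite -(preimage_setT (fun n => iter n g y)).
  by apply: finite_preimage => // i j _ _; apply: orbit_inj.
elim: i j => [|i IH] [|j] //=.
- by move=> e; case: ny; exists (iter j g y).
- by move=> e; case: ny; exists (iter i g y).
- by move=> /ginj/IH ->.
Qed.

(** * Concatenation of tuples *)

Section tuples.
Variable T : Type.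

Lemma tcons0 n (x : T) (v : 'I_n -> T) : tcons x v ord0 = x.
Proof. by rewrite /tcons unlift_none. Qed.

Lemma tconsS n (x : T) (v : 'I_n -> T) i : tcons x v (lift ord0 i) = v i.
Proof. by rewrite /tcons liftK. Qed.

Lemma tcons_eta n (w : 'I_n.+1 -> T) :
  tcons (w ord0) (fun i => w (lift ord0 i)) = w.
Proof.
by apply/funext => i; rewrite /tcons; case: unliftP => [j ->|->].
Qed.

Lemma tuple0_eq (u v : 'I_0 -> T) : u = v.
Proof. by apply/funext => -[]. Qed.

Lemma tcat_tuple0 n (v : 'I_n -> T) : tcat (@Defs.tuple0 T) v = v.
Proof.
apply/funext => i; rewrite /tcat.
case: split_ordP => [[]//|j ->].
by congr v; apply/val_inj.
Qed.

Lemma tcat_tcons m n x (u : 'I_m -> T) (v : 'I_n -> T) :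
  tcat (tcons x u) v = tcons x (tcat u v).
Proof.
apply/funext => i; rewrite {1}/tcat.
case: split_ordP => [j ->|j ->].
  rewrite {1}/tcons; case: unliftP => [l ->|->].
    rewrite (_ : lshift n (lift ord0 l) = lift ord0 (lshift n l)).
      by rewrite tconsS /tcat; case: split_ordP => [p /lshift_inj -> //|p /eqP];
        rewrite eq_lrshift.
    exact/val_inj.
  by rewrite (_ : lshift n ord0 = ord0) ?tcons0//; apply/val_inj.
rewrite (_ : rshift m.+1 j = lift ord0 (rshift m j)); last exact/val_inj.
by rewrite tconsS /tcat; case: split_ordP => [p /eqP|p /rshift_inj -> //];
  rewrite eq_rlshift.
Qed.

End tuples.

Lemma comp_tcons (T U : Type) n (h : T -> U) x (v : 'I_n -> T) :
  h \o tcons x v = tcons (h x) (h \o v).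
Proof. by apply/funext => i /=; rewrite /tcons; case: unlift. Qed.

(** * Vanishing of formulas with quantifiers *)

Section values.
Variables (R : realType) (L : signature R) (M : structure L).

Lemma value_itv n (phi : formula L n) (v : 'I_n -> M) : 0 <= value phi v <= 1.
Proof.
have [m0] := carrier_inhabited M.
elim: phi v => {n} /=.
- by move=> n t u v; rewrite mdist_ge0 diam_le1.
- by move=> n s ts v; exact: pinterp_itv.
- move=> n k u phis IH v; apply: connective_itv => i.
  by rewrite mxE; exact: IH.
- move=> n psi IH v; have IH0 x := IH (tcons x v); apply/andP; split.
    have /andP[+ _] := IH0 m0 => /le_trans; apply.
    apply: ub_le_sup; last by exists m0.
    by exists 1 => _ [x _ <-]; case/andP: (IH0 x).
  apply: ge_sup; first by exists (value psi (tcons m0 v)); exists m0.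
  by move=> _ [x _ <-]; case/andP: (IH0 x).
- move=> n psi IH v; have IH0 x := IH (tcons x v); apply/andP; split.
    apply: lb_le_inf; first by exists (value psi (tcons m0 v)); exists m0.
    by move=> _ [x _ <-]; case/andP: (IH0 x).
  have /andP[_] := IH0 m0; apply: le_trans.
  apply: ge_inf; last by exists m0.
  by exists 0 => _ [x _ <-]; case/andP: (IH0 x).
Qed.

Lemma value_ge0 n (phi : formula L n) (v : 'I_n -> M) : 0 <= value phi v.
Proof. by case/andP: (value_itv phi v). Qed.

Lemma value_Sup_eq0 n (psi : formula L n.+1) (v : 'I_n -> M) :
  value (Sup psi) v = 0 <-> forall x : M, value psi (tcons x v) = 0.
Proof.
split=> /= [s0 x|psi0].
  apply/eqP; rewrite eq_le value_ge0 andbT -s0.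
  apply: ub_le_sup; last by exists x.
  by exists 1 => _ [y _ <-]; case/andP: (value_itv psi (tcons y v)).
have [m0] := carrier_inhabited M.
rewrite -[RHS](sup1 0); congr sup.
apply/seteqP; split=> [_ [x _ <-]//=|_ ->]; exists m0 => //=.
Qed.

(** Only one direction, since an infimum need not be attained in general. *)
Lemma value_Inf_eq0 n (psi : formula L n.+1) (v : 'I_n -> M) (x : M) :
  value psi (tcons x v) = 0 -> value (Inf psi) v = 0.
Proof.
move=> psi0; apply/eqP; rewrite eq_le value_ge0 andbT -psi0 /=.
apply: ge_inf; last by exists x.
by exists 0 => _ [y _ <-]; exact: value_ge0.
Qed.

(** Finitely many positive values have a common positive lower bound, which would also bound the
    infimum. *)
Lemma finite_value_Inf_eq0 n (psi : formula L n.+1) (v : 'I_n -> M) :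
  finite_structure M -> value (Inf psi) v = 0 ->
  exists x : M, value psi (tcons x v) = 0.
Proof.
move=> finM inf0; apply: contrapT => npsi.
have [m0] := carrier_inhabited M.
have psi_gt0 x : 0 < value psi (tcons x v).
  by rewrite lt_neqAle value_ge0 andbT eq_sym; apply/eqP => ?; apply: npsi; exists x.
have : \forall e \near 0^'+, forall x, [set: M] x -> e <= value psi (tcons x v).
  apply: filter_finite_forall => // x _.
  by near=> e; near: e; apply: nbhs_right_le.
move=> /(filterI (nbhs_right_gt 0))/filter_ex[e /= [e0 le_e]].
have : e <= value (Inf psi) v.
  apply: lb_le_inf; first by exists (value psi (tcons m0 v)); exists m0.
  by move=> _ [x _ <-]; exact: le_e.
by rewrite inf0 leNgt e0.
Unshelve. all: by end_near. Qed.

End values.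

(** Strong pseudofiniteness speaks of sentences only, so parameters are traded for infima; in a
    finite structure they are recovered because these infima are attained. *)
Fixpoint inf_closure (R : realType) (L : signature R) (n : nat) :
    formula L n -> sentence L :=
  match n with
  | 0 => fun phi => phi
  | _.+1 => fun phi => inf_closure (Inf phi)
  end.

Lemma inf_closure_eq0 (R : realType) (L : signature R) (M : structure L) n
    (phi : formula L n) (v : 'I_n -> M) :
  value phi v = 0 -> sentence_value M (inf_closure phi) = 0.
Proof.
elim: n phi v => [|n IH] phi v /= phi0.
  by rewrite /sentence_value (tuple0_eq (@Defs.tuple0 M) v).
apply: (IH _ (fun i => v (lift ord0 i))).
by apply: (@value_Inf_eq0 _ _ _ _ _ _ (v ord0)); rewrite tcons_eta.
Qed.

Lemma finite_inf_closure_eq0 (R : realType) (L : signature R)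
    (A : structure L) n (phi : formula L n) :
  finite_structure A -> sentence_value A (inf_closure phi) = 0 ->
  exists v : 'I_n -> A, value phi v = 0.
Proof.
move=> finA; elim: n phi => [|n IH] phi /= phi0; first by exists (@Defs.tuple0 A).
have [v /(finite_value_Inf_eq0 finA)[x xv0]] := IH _ phi0.
by exists (tcons x v).
Qed.

(** * Renaming of free variables *)

Section renaming.
Variables (R : realType) (L : signature R).

Fixpoint trename n m (r : 'I_n -> 'I_m) (t : term L n) : term L m :=
  match t with
  | Var i => Var L (r i)
  | Cst c => Cst m c
  | App s ts => App (fun i => trename r (ts i))
  end.

(** A renaming is itself a tuple of indices, so [tcons] carries it under a quantifier, where
    variable 0 is bound. *)
Definition rename_up n m (r : 'I_n -> 'I_m) : 'I_n.+1 -> 'I_m.+1 :=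
  tcons ord0 (fun i => lift ord0 (r i)).

Fixpoint frename n (phi : formula L n) : forall m, ('I_n -> 'I_m) -> formula L m :=
  match phi in formula _ n return forall m, ('I_n -> 'I_m) -> formula L m with
  | Dist _ t u => fun m r => Dist (trename r t) (trename r u)
  | Pred _ s ts => fun m r => Pred (fun i => trename r (ts i))
  | Conn _ _ c phis => fun m r => Conn c (fun i => frename (phis i) r)
  | Sup _ psi => fun m r => Sup (frename psi (rename_up r))
  | Inf _ psi => fun m r => Inf (frename psi (rename_up r))
  end.

Variable M : structure L.

Lemma tvalue_rename n m (r : 'I_n -> 'I_m) (t : term L n) (v : 'I_m -> M) :
  tvalue v (trename r t) = tvalue (v \o r) t.
Proof. by elim: t => //= s ts IH; congr finterp; apply/funext. Qed.

Lemma tcons_rename_up n m (r : 'I_n -> 'I_m) x (v : 'I_m -> M) :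
  tcons x v \o rename_up r = tcons x (v \o r).
Proof.
rewrite comp_tcons tcons0; congr tcons.
by apply/funext => i /=; rewrite tconsS.
Qed.

Lemma value_rename n (phi : formula L n) m (r : 'I_n -> 'I_m) (v : 'I_m -> M) :
  value (frename phi r) v = value phi (v \o r).
Proof.
elim: phi m r v => {n} /=.
- by move=> n t u m r v; rewrite !tvalue_rename.
- move=> n s ts m r v; congr pinterp; apply/funext => i; exact: tvalue_rename.
- by move=> n k c phis IH m r v; congr (c _); apply/rowP => i; rewrite !mxE IH.
- move=> n psi IH m r v; congr sup; apply: eq_imagel => x _.
  by rewrite IH tcons_rename_up.
- move=> n psi IH m r v; congr inf; apply: eq_imagel => x _.
  by rewrite IH tcons_rename_up.
Qed.

End renaming.

(** * Zero sets of connectives, and saturation *)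

Lemma closed_zero_connective (R : realType) k (C : set 'rV[R]_k) :
  closed C -> C !=set0 -> exists c : connective R k, forall v, c v = 0 <-> C v.
Proof.
move=> clC [a Ca].
(* The distance to [C] is an extended real; the point [a] of [C] makes it finite. *)
have dfin v : edist_inf C v \is a fin_num.
  rewrite ge0_fin_numE ?edist_inf_ge0//; apply: (@le_lt_trans _ _ (edist (v, a))).
    by apply: ereal_inf_lbound; exists a.
  rewrite -ge0_fin_numE ?edist_ge0//; apply/edist_finP.
  exists (`|v - a| + 1) => /=; first by rewrite ltr_wpDl.
  by rewrite -(@ball_normE R 'rV[R]_k) /= ltrDl.
(* The distance to [C], truncated at 1 to be a connective; it vanishes exactly on the closure of
   [C], which is [C]. *)
pose f := (fun v => fine (edist_inf C v)) \min (fun=> 1).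
have fcont : continuous f.
  move=> v; apply: continuous_min; last exact: cst_continuous.
  rewrite /continuous_at; apply: (@fine_cvg R _ (nbhs v) _ (edist_inf C)).
  rewrite fineK; last exact: dfin.
  exact: edist_inf_continuous.
have f01 v : 0 <= f v <= 1.
  by rewrite /f /= le_min ge_min lexx orbT ler01 fine_ge0 ?edist_inf_ge0//.
exists (Connective (continuous_subspaceT fcont) (fun v _ => f01 v)) => v /=.
split=> [|Cv]; last by rewrite /f /= edist_inf0// min_l.
rewrite /f /= => /eqP.
rewrite minEle; case: ifP => _; last by rewrite oner_eq0.
rewrite fine_eq0// => /eqP d0.
apply: clC => B /nbhs_ballP[e /= e0 eB].
have : (edist_inf C v < e%:E)%E by rewrite d0 lte_fin.
move=> /ereal_inf_lt[_ [b Cb <-] /edist_lt_ball vb].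
by exists b; split=> //; exact: eB.
Qed.

(** Finitely many conditions, each holding on a set of [F], hold together on a set of [F], which is
    nonempty; so saturation applies. *)
Lemma saturated_filter (R : realType) (L : signature R) (M : structure L)
    n k (a : 'I_k -> M) (F : set_system ('I_n -> M)) :
  omega_saturated M -> ProperFilter F ->
  exists x, realizes a [set phi | F [set u | value phi (tcat u a) = 0]] x.
Proof.
move=> satM FF; apply: satM => Sigma0 fin0 sub0.
have : F [set u | realizes a Sigma0 u].
  by apply: filter_finite_forall => // phi /sub0.
exact: filter_ex.
Qed.

(* A point v of the closure gives the filter of the sets containing all tuples
   whose row of values is close enough to v; it remains to realize its type. *)
Lemma saturated_closed_values (R : realType) (L : signature R)
    (M : structure L) n k q (a : 'I_k -> M) (phis : 'I_q -> formula L (n + k)) :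
  omega_saturated M ->
  closed (range (fun x : 'I_n -> M => \row_i value (phis i) (tcat x a))).
Proof.
move=> satM v vcl; set h := fun x : 'I_n -> M => _ in vcl.
pose F := [set P : set ('I_n -> M) | nbhs v [set w | forall x, h x = w -> P x]].
have FF : ProperFilter F.
  split; last first.
    split.
    - by apply: (@filterE _ (nbhs v)).
    - move=> P Q FP FQ.
      apply: (@filterS2 _ (nbhs v) _ _ _ _ _ FP FQ) => w wP wQ x xw.
      by split; auto.
    - by move=> P Q PQ; apply: (@filterS _ (nbhs v)) => w wP x /wP; exact: PQ.
  (* Properness of [F] is exactly that [v] lies in the closure of the range. *)
  move=> F0; have [w [[x _ xw] /(_ _ xw)]] := vcl _ F0; exact.
have [x xF] := @saturated_filter _ _ _ _ _ a _ satM FF.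
exists x => //; apply: norm_hausdorff => A B /nbhs_singleton Ax.
(* To place [h x] in [B], shrink [B] to a neighbourhood [C] of [v] with closure inside [B]. A
   connective with zero set the closure of [C] gives a condition true on a set of [F], hence true at
   [x]. *)
move=> /uniform_regular[C Cv CB]; exists (h x); split=> //; apply: CB.
have [|c cC] := closed_zero_connective (@closed_closure _ C).
  by exists v; apply: subset_closure; exact: nbhs_singleton.
apply/cC/(xF (Conn c phis)).
apply: filterS Cv => w Cw u uw; apply/cC.
by rewrite -[X in closure C X]/(h u) uw; apply: subset_closure.
Qed.

(** * The quadruples and the formulas that define them *)

Section profile.
Variables (R : realType) (L : signature R) (k : nat) (phi : formula L k.+2).

(** The arguments follow the order of the variables, innermost quantifier first. The structure is
    arbitrary because quadruples of the finite structure will be matched with quadruples of [M]. *)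
Definition profile (N : structure L) (x' y x y0 : N) (a : 'I_k -> N) :
    'rV[R]_4 :=
  \row_i tcons (mdist x x')
    (tcons (value phi (tcons x (tcons y a)))
      (tcons (value phi (tcons x' (tcons y a)))
        (tcons (value phi (tcons x (tcons y0 a))) (@Defs.tuple0 R)))) i.

Lemma profileE (N : structure L) (x' y x y0 : N) (a : 'I_k -> N) :
  let p := profile x' y x y0 a in
  [/\ p ord0 ord0 = mdist x x',
      p ord0 (lift ord0 ord0) = value phi (tcons x (tcons y a)),
      p ord0 (lift ord0 (lift ord0 ord0)) = value phi (tcons x' (tcons y a)) &
      p ord0 (lift ord0 (lift ord0 (lift ord0 ord0))) =
        value phi (tcons x (tcons y0 a))].
Proof. by rewrite /profile /= !mxE !tconsS !tcons0. Qed.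

(** Variables 0 to 3 stand for x', y, x, y0, and the last k for the parameters a. *)
Let var0 : 'I_k.+4 := ord0.
Let var1 : 'I_k.+4 := lift ord0 ord0.
Let var2 : 'I_k.+4 := lift ord0 (lift ord0 ord0).
Let var3 : 'I_k.+4 := lift ord0 (lift ord0 (lift ord0 ord0)).
Let vars (i : 'I_k) : 'I_k.+4 := lift ord0 (lift ord0 (lift ord0 (lift ord0 i))).

Definition phi_at (i j : 'I_k.+4) : formula L k.+4 :=
  frename phi (tcons i (tcons j vars)).

Definition profile_formulas : 'I_4 -> formula L k.+4 :=
  tcons (Dist (Var L var2) (Var L var0))
    (tcons (phi_at var2 var1)
      (tcons (phi_at var0 var1)
        (tcons (phi_at var2 var3) (@Defs.tuple0 (formula L k.+4))))).

Lemma profile_formulasE (N : structure L) (x' y x y0 : N) (a : 'I_k -> N) :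
  \row_i value (profile_formulas i) (tcons x' (tcons y (tcons x (tcons y0 a)))) =
  profile x' y x y0 a.
Proof.
apply/rowP => i; rewrite !mxE.
set w := tcons x' _.
have wvars : w \o vars = a by apply/funext => l; rewrite /= /w !tconsS.
have phi_atE j l :
    value (phi_at j l) w = value phi (tcons (w j) (tcons (w l) a)).
  by rewrite value_rename !comp_tcons wvars.
rewrite /profile_formulas.
case: (unliftP ord0 i) => [{}i ->|->]; rewrite ?tconsS ?tcons0.
  case: (unliftP ord0 i) => [{}i ->|->]; rewrite ?tconsS ?tcons0.
    case: (unliftP ord0 i) => [{}i ->|->]; rewrite ?tconsS ?tcons0.
      case: (unliftP ord0 i) => [[]//|->]; rewrite ?tcons0.
      by rewrite phi_atE /w !tconsS !tcons0.
    by rewrite phi_atE /w !tconsS !tcons0.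
  by rewrite phi_atE /w !tconsS !tcons0.
by rewrite /= /w !tconsS !tcons0.
Qed.

End profile.

(** * Transfer to a finite structure *)

Theorem proposition6p2 (R : realType) (L : signature R) (M : structure L)
    (f : M -> M) :
  omega_saturated M -> strongly_pseudofinite M -> formula_definable f ->
  injective f -> forall y : M, exists x : M, f x = y.
Proof.
move=> satM spfM [k [phi [a phiE]]] finj y0; apply: contrapT => ny0.
(* The graph condition y = f x is expressed by a zero second entry: saturation handles all triples
   x', y, x, and a closed condition then cuts out the graph. *)
pose S := [set v | exists x' y x : M, v = profile phi x' y x y0 a] `&`
          [set v : 'rV[R]_4 | v ord0 (lift ord0 ord0) = 0].
have profileS x' x : S (profile phi x' (f x) x y0 a).
  split; first by exists x', (f x), x.
  by have [_ /= -> _ _] := profileE phi x' (f x) x y0 a; rewrite -phiE mdistxx.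
have clS : closed S.
  apply: closedI.
    (* Here [y0] joins [a] as a parameter. *)
    rewrite (_ : mkset _ = range (fun u : 'I_3 -> M =>
        \row_i value (profile_formulas phi i) (tcat u (tcons y0 a)))).
      exact: saturated_closed_values.
    apply/seteqP; split=> [_ [x' [y [x ->]]]|_ [u _ <-]].
      exists (tcons x' (tcons y (tcons x (@Defs.tuple0 M)))) => //.
      by rewrite !tcat_tcons tcat_tuple0 profile_formulasE.
    exists (u ord0), (u (lift ord0 ord0)), (u (lift ord0 (lift ord0 ord0))).
    rewrite -[u in LHS]tcons_eta -[X in tcons _ X]tcons_eta.
    rewrite -[X in tcons _ (tcons _ X)]tcons_eta.
    rewrite !tcat_tcons [X in tcat X _](tuple0_eq _ (@Defs.tuple0 M)).
    by rewrite tcat_tuple0 profile_formulasE.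
  apply: (@preimage_closed _ _ (fun v : 'rV[R]_4 => v ord0 (lift ord0 ord0)) [set 0]).
    by move=> v _; exact: coord_continuous.
  exact: closed_eq.
have [m0] := carrier_inhabited M.
have [|c cS] := closed_zero_connective clS.
  by exists (profile phi m0 (f m0) m0 y0 a).
pose psi := Sup (Inf (Sup (Conn c (profile_formulas phi)))).
have : sentence_value M (inf_closure psi) = 0.
  apply: (@inf_closure_eq0 _ _ _ _ _ (tcons y0 a)).
  apply/value_Sup_eq0 => x; apply: (value_Inf_eq0 (x := f x)).
  by apply/value_Sup_eq0 => x' /=; rewrite profile_formulasE; apply/cS.
move=> /spfM[A [finA /(finite_inf_closure_eq0 finA)[b]]].
(* In [A], [b0] plays the role of [y0] and [bs] that of [a]. *)
rewrite -(tcons_eta b); set b0 := b ord0; set bs := fun i => b _.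
move=> /value_Sup_eq0 psiA.
(* The infimum over y stands outside the supremum over x', so a single y serves every x'. *)
have /choice[g gS] : forall x : A, exists y : A, forall x' : A,
    S (profile phi x' y x b0 bs).
  move=> x; have [y /value_Sup_eq0 xy] := finite_value_Inf_eq0 finA (psiA x).
  by exists y => x'; apply/cS; rewrite -profile_formulasE; exact: xy.
have g0 x : value phi (tcons x (tcons (g x) bs)) = 0.
  by have [_ /= <- _ _] := profileE phi x (g x) x b0 bs; have [] := gS x x.
have ginj : injective g.
  move=> x x' gxx'; apply/mdist_positivity.
  (* The quadruple of x', g x, x in [A] is that of some z', y, z in [M]. Its second and third
     entries vanish, so f z = y = f z', hence z = z' and the first entry is 0. *)
  have [[z' [y [z pE]]] p1] := gS x x'.
  have [/= <- _ p2 _] := profileE phi x' (g x) x b0 bs.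
  have [/= d q1 q2 _] := profileE phi z' y z y0 a.
  move: p1 p2; rewrite /= pE d q1 q2 gxx' g0 -!phiE.
  by move=> /mdist_positivity <- /mdist_positivity/finj ->; rewrite mdistxx.
have [x gx] := finite_injective_surjective finA ginj b0.
(* As g x = [b0], the fourth entry vanishes; read in [M], this says f z = [y0]. *)
have [[z' [y [z pE]]] _] := gS x x.
have [_ _ _ /= p3] := profileE phi x (g x) x b0 bs.
have [_ _ _ /= q3] := profileE phi z' y z y0 a.
move: p3; rewrite pE q3 -gx g0 -phiE => /mdist_positivity zy0.
by apply: ny0; exists z.
Qed.
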